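(* Let $\Gamma' = \{F\in\Gamma : \operatorname{char}(F)\neq 2\}$. Then $\Gamma'\subset\Lambda\subset\Gamma$. That is: (i) if $F$ is a field with $\operatorname{char}(F)\neq 2$ such that every polynomial of odd degree with coefficients in $F$ has a root in $F$, then every finite-dimensional $F$-algebra contains either an idempotent or an absolute nilpotent; (ii) if $F$ is a field (of arbitrary characteristic) such that every finite-dimensional $F$-algebra contains either an idempotent or an absolute nilpotent, then every polynomial of odd degree with coefficients in $F$ has a root in $F$.
   Context: For a field $F$, an $F$-algebra is a vector space $A$ over $F$ with a bilinear multiplication $A\times A\to A$, $(x,y)\mapsto xy$; associativity, commutativity and existence of a unit are not assumed. Finite-dimensional means $1\le \dim_F A<\infty$. An idempotent of $A$ is $x\in A$, $x\neq 0$, with $x^2=x$. An absolute nilpotent of $A$ is $x\in A$, $x\neq 0$, with $x^2=0$. $\Lambda$ is the class of fields $F$ such that every finite-dimensional $F$-algebra contains either an idempotent or an absolute nilpotent. $\Gamma$ is the class of fields $F$ such that every polynomial of odd degree with coefficients in $F$ has a root in $F$. *)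

(* Defs.v *)
From mathcomp Require Import all_boot all_algebra.

Set Implicit Arguments.
Unset Strict Implicit.
Unset Printing Implicit Defensive.

Import GRing.Theory.
Local Open Scope ring_scope.

(* An F-algebra is a vector space A with a bilinear multiplication
   mul : {bilinear A -> A -> A}, carried separately from A because MathComp's
   algebra structures are all associative and unital. *)

Definition idempotent_elt (F : fieldType) (A : vectType F)
    (mul : {bilinear A -> A -> A}) (x : A) : Prop :=
  x != 0 /\ mul x x = x.

Definition absolute_nilpotent (F : fieldType) (A : vectType F)
    (mul : {bilinear A -> A -> A}) (x : A) : Prop :=
  x != 0 /\ mul x x = 0.

(* A vectType is finite-dimensional, but possibly of dimension 0. *)
Definition Lambda (F : fieldType) : Prop :=
  forall (A : vectType F) (mul : {bilinear A -> A -> A}),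
    (1 <= \dim {:A})%N ->
    (exists x : A, idempotent_elt mul x) \/
    (exists x : A, absolute_nilpotent mul x).

(* (size p).-1 is the degree of p when p != 0, and 0, which is even, when
   p = 0. *)
Definition Gamma (F : fieldType) : Prop :=
  forall p : {poly F}, odd (size p).-1 -> exists x : F, root p x.

Definition Gamma' (F : fieldType) : Prop :=
  Gamma F /\ 2%N \notin [pchar F].

(* Main.v *)
From HB Require Import structures.
Require Import Defs.
From mathcomp Require Import all_boot all_algebra all_field.
From mathcomp Require Import ring zify.
From Stdlib Require Import Classical.

Set Implicit Arguments.
Unset Strict Implicit.
Unset Printing Implicit Defensive.

Import GRing.Theory.
Local Open Scope ring_scope.

(* (ii) If p is irreducible of odd degree at least 3, let L = F[X]/(p) and let
   U be a complement of the line F in L, with x . y the projection of xy onto U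
   along F.  If x . x is a multiple of x, then x is a root of a quadratic
   polynomial over F; as [L : F] is odd, x lies in F and in U, so x = 0.

   (i) In coordinates, squaring is a quadratic map f : F^n -> F^n, and one wants
   x <> 0 with f(x) proportional to x.  Deform f into
   f_X(x)_i = x_i^2 + X (f_i(x) - x_i^2).  At X = 0 the nonzero idempotents are
   the 2^n - 1 nonzero 0/1 vectors; they lift to power series in X, and the
   multiplications by the coordinates on this set of points, expressed in the
   basis of nonconstant squarefree monomials, are commuting matrices A_i of the
   odd size 2^n - 1 with entries that become polynomial in X after clearing
   denominators, and with A_i f_X(A)_j = A_j f_X(A)_i.  To specialize at X = 1,
   choose c in F^n such that det(sum_i c_i A_i) vanishes there to the least
   order: then the A_i / (sum_j c_j A_j) are integral over the local ring at 1,
   so they stabilize a lattice, and reducing them modulo X - 1 gives commuting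
   matrices C_i over F, not all nilpotent, with C_i f(C)_j = C_j f(C)_i.  Since
   polynomials of odd degree have roots in F, commuting matrices of odd size
   have a common eigenvector; the eigenvalues are the coordinates of x. *)

(** * From idempotents to roots of odd-degree polynomials *)

Definition proj_mul (F : fieldType) (L : fieldExtType F) (U : {vspace L})
    (x y : subvs_of U) : subvs_of U :=
  vsproj U (daddv_pi U 1 (vsval x * vsval y)).

Lemma proj_mul_bilinear (F : fieldType) (L : fieldExtType F) (U : {vspace L}) :
  bilinear_for (GRing.Scale.Law.clone _ _ *:%R _)
    (GRing.Scale.Law.clone _ _ *:%R _) (@proj_mul F L U).
Proof.
split=> [u'|u] a x y; rewrite /proj_mul.
  rewrite (_ : vsval (a *: x + y) = a *: vsval x + vsval y) //.
  by rewrite mulrDl -scalerAl !linearP.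
rewrite (_ : vsval (a *: x + y) = a *: vsval x + vsval y) //.
by rewrite mulrDr -scalerAr !linearP.
Qed.

HB.instance Definition _ (F : fieldType) (L : fieldExtType F)
    (U : {vspace L}) :=
  bilinear_isBilinear.Build F (subvs_of U) (subvs_of U) (subvs_of U) _ _
    (@proj_mul F L U) (proj_mul_bilinear U).

(** The degree of [x] over [F] is at most 2 and divides the odd degree of [L], so it is 1. *)
Lemma quadratic_in_odd_ext (F : fieldType) (L : fieldExtType F) (x : L)
    (a b : F) :
  odd (\dim {:L}) -> x * x = a *: x + b%:A -> x \in 1%VS.
Proof.
move=> oddL xx.
pose p : {poly L} := 'X^2 - (a%:A *: 'X + (b%:A)%:P).
have mem1 (c : F) : c%:A \in (1%AS : {subfield L}).
  by rewrite rpredZ ?mem1v.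
have pK : p \is a polyOver (1%AS : {subfield L}).
  by rewrite rpredB ?rpredX ?rpredD ?polyOverX ?polyOverC // polyOverZ ?polyOverX.
have sp : size p = 3%N.
  rewrite /p size_polyDl size_polyXn // size_polyN.
  rewrite (leq_ltn_trans (size_polyD _ _)) // gtn_max ltnS.
  rewrite (leq_trans (size_scale_leq _ _)) ?size_polyX //=.
  by rewrite (leq_ltn_trans (size_polyC_leq1 _)).
have px : root p x.
  by rewrite /root !hornerE expr2 xx -scalerAl mul1r subrr.
have := dvdp_leq _ (minPoly_dvdp pK px).
rewrite -size_poly_gt0 sp size_minPoly => /(_ isT); rewrite ltnS => le2.
have dvdL : (adjoin_degree (1%AS : {subfield L}) x %| \dim {:L})%N.
  have := dim_Fadjoin 1%AS x; rewrite dimv1 muln1 => <-.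
  exact: (field_dimS (subvf (<<1; x>>%AS))).
move: le2 dvdL; case E: (adjoin_degree _ x) => [|[|[|d]]] // _.
- by move=> _; rewrite -(adjoin_deg_eq1 1%AS x) E.
- by rewrite dvdn2 oddL.
Qed.

Lemma Lambda_irreducible_odd (F : fieldType) (p : {poly F}) :
  Lambda F -> irreducible_poly p -> odd (size p).-1 -> size p = 2%N.
Proof.
move=> LF irr_p odd_p; apply/eqP; apply: contraT => sp2.
have [L dimL _] := irredp_FAdjoin irr_p.
have sp : (1 < (size p).-1)%N.
  by move: odd_p sp2; case: (size p) => [|[|[|m]]].
set U : {vspace L} := (1%VS^C)%VS.
have capU : (U :&: 1)%VS = 0%VS by rewrite capvC capv_compl.
have addU : (U + 1)%VS = fullv by rewrite addvC addv_complf.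
have memU (x : subvs_of U) : vsval x \in 1%VS -> x = 0.
  move=> x1; apply: val_inj; apply/eqP; rewrite -memv0 -capU memv_cap x1 andbT.
  exact: subvsP.
(* An idempotent is the case [t = 1], an absolute nilpotent the case [t = 0]. *)
have key (x : subvs_of U) (t : F) : proj_mul x x = t *: x -> x = 0.
  move/(congr1 vsval); rewrite /proj_mul vsprojK ?memv_pi //= => xx.
  have : vsval x * vsval x \in (U + 1)%VS by rewrite addU memvf.
  move/(daddv_pi_add capU); rewrite xx.
  have /vlineP[c ->] : daddv_pi 1 U (vsval x * vsval x) \in <[1]>%VS.
    exact: memv_pi.
  move/esym => xx'; apply: memU; apply: (quadratic_in_odd_ext _ xx').
  by rewrite dimL.
have dimA : (1 <= \dim {: subvs_of U})%N.
  rewrite dimvf /dim /= lt0n dimv_compl dimv1 dimL.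
  by rewrite -lt0n subn_gt0.
case: (LF _ (@proj_mul F L U) dimA) => [[x [x0 xx]]|[x [x0 xx]]].
  by rewrite (key x 1) ?scale1r ?eqxx // in x0.
by rewrite (key x 0) ?scale0r ?eqxx // in x0.
Qed.

(** Strong induction on the size: if [p] factors properly, the degrees of the two factors have odd
    sum, so one factor has odd degree and, by induction, a root. *)
Lemma Lambda_Gamma (F : fieldType) : Lambda F -> Gamma F.
Proof.
move=> LF p; have [m] := ubnP (size p).
elim: m p => // m IHm p; rewrite ltnS => sp odd_p.
have p_neq0 : p != 0 by apply: contraTneq odd_p => ->; rewrite size_poly0.
have sp_gt1 : (1 < size p)%N by move: odd_p; case: (size p) => [|[]].
have [irr_p|] := classic (irreducible_poly p).
  have /poly2_root[x px] := Lambda_irreducible_odd LF irr_p odd_p.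
  by exists x.
move=> red_p.
have [q [sq qp npq]] : exists q : {poly F}, [/\ size q != 1%N, q %| p & ~ (q %= p)].
  apply: NNPP => H; apply: red_p; split=> // q sq qp.
  by apply: NNPP => npq; apply: H; exists q.
have [r pE] := dvdpP _ _ qp.
have q0 : q != 0 by apply: contraNneq p_neq0 => q0; rewrite pE q0 mulr0.
have r0 : r != 0 by apply: contraNneq p_neq0 => r0; rewrite pE r0 mul0r.
have sr : size r != 1%N.
  apply/negP => sr; apply: npq; rewrite pE -{1}[q]mul1r eqp_mul2r //.
  by rewrite eqp_sym -size_poly_eq1.
have spE : (size p).-1 = ((size r).-1 + (size q).-1)%N.
  rewrite pE size_mul //; move: r0 q0; rewrite -2!size_poly_gt0.
  by move: (size r) (size q) => a b; lia.
have gt1 (s : {poly F}) : s != 0 -> size s != 1%N -> (1 < size s)%N.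
  by rewrite -size_poly_gt0; case: (size s) => [|[]].
have := gt1 _ q0 sq; have := gt1 _ r0 sr => r1 q1.
move: odd_p; rewrite spE oddD; case E: (odd (size q).-1) => odd_r.
  have [|x qx] := IHm q _ E; first by lia.
  by exists x; rewrite pE rootM qx orbT.
have [||x rx] := IHm r; first by lia.
  by rewrite addbF in odd_r.
by exists x; rewrite pE rootM rx.
Qed.

(** * Common eigenvectors of commuting matrices of odd size *)

(** This serves as infinitude of [F]. If [q] of odd degree vanished everywhere, [q + 1] would have
    odd degree and no root; an even degree is made odd by the factor ['X]. *)
Lemma Gamma_poly_eq0 (F : fieldType) (p : {poly F}) :
  Gamma F -> (forall x, p.[x] = 0) -> p = 0.
Proof.
move=> GF p_van; apply: contraTeq isT => p_neq0.
have odd_nonvan (q : {poly F}) : odd (size q).-1 -> ~ (forall x, q.[x] = 0).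
  move=> oddq qvan; have [|x] := GF (q + 1).
    by rewrite size_polyDl // size_poly1; move: oddq; case: (size q) => [|[]].
  by rewrite /root hornerD qvan hornerC add0r oner_eq0.
case E: (odd (size p).-1); first by case: (odd_nonvan p E).
case: (odd_nonvan (p * 'X)) => [|x]; last by rewrite hornerM p_van mul0r.
rewrite size_mulX //=; move: p_neq0 E; rewrite -size_poly_gt0.
by case: (size p) => //= n _ ->.
Qed.

(** If some [C i0] is not scalar, its characteristic polynomial has a root [a], and [T = C i0 - a]
    is singular, nonzero and commutes with the family. Its image and kernel are stable proper
    subspaces whose dimensions add up to the odd [N], so the induction applies to one of them. *)
Lemma common_eigenvector (F : fieldType) (N n : nat) (C : 'I_n -> 'M[F]_N) :
  Gamma F -> odd N -> (forall i j, C i *m C j = C j *m C i) ->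
  exists v : 'rV[F]_N, v != 0 /\
    exists lam : 'I_n -> F, forall i, v *m C i = lam i *: v.
Proof.
move=> GF; have [m] := ubnP N; elim: m N C => // m IHm N C.
rewrite ltnS => leNm oddN comC.
have N_gt0 : (0 < N)%N by case: (N) oddN.
have [scalC|] := classic (forall i, exists a : F, C i = a%:M).
  have [lam lamE] := fin_all_exists scalC.
  exists (const_mx 1); split; last by exists lam => i; rewrite lamE mul_mx_scalar.
  by apply/rV0Pn; exists (Ordinal N_gt0); rewrite mxE oner_eq0.
move/not_all_ex_not=> [i0 nscal].
have [|a rooa] := GF (char_poly (C i0)); first by rewrite size_char_poly.
pose T := C i0 - a%:M.
have comT i : C i *m T = T *m C i.
  by rewrite mulmxBr mulmxBl comC mul_mx_scalar mul_scalar_mx.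
have T_neq0 : T != 0.
  by apply/eqP => /(canRL (subrK _)); rewrite add0r => T0; apply: nscal; exists a.
have ltT : (\rank T < N)%N.
  rewrite ltn_neqAle rank_leq_row andbT; move: rooa.
  rewrite -eigenvalue_root_char /eigenvalue /eigenspace -mxrank_eq0 mxrank_ker.
  by rewrite subn_eq0 -ltnNge => /ltn_eqF ->.
have T_gt0 : (0 < \rank T)%N by rewrite lt0n mxrank_eq0.
have stable_case (U : 'M[F]_N) : odd (\rank U) -> (\rank U < N)%N ->
    (forall i, (U *m C i <= U)%MS) ->
    exists v : 'rV[F]_N, v != 0 /\
      exists lam : 'I_n -> F, forall i, v *m C i = lam i *: v.
  move=> oddU ltU stU; set B := row_base U.
  (* [D i] is the action of [C i] on the row space of [U], in the basis [B]. *)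
  have [D BC] : exists D : 'I_n -> 'M_(\rank U), forall i, B *m C i = D i *m B.
    exists (fun i => B *m C i *m pinvmx B) => i.
    by rewrite mulmxKpV // eq_row_base (eqmxMr _ (eq_row_base U)).
  have freeB : row_free B := row_base_free U.
  have [||i j|w [w0 [lam wE]]] := IHm _ D => //; first exact: leq_trans leNm.
    have DB k l : D k *m D l *m B = B *m (C k *m C l).
      by rewrite -mulmxA -BC mulmxA -BC mulmxA.
    by apply: (row_free_inj freeB); rewrite !DB comC.
  exists (w *m B); split.
    by apply: contra_neq w0 => wB0; apply: (row_free_inj freeB); rewrite mul0mx.
  by exists lam => i; rewrite -mulmxA BC mulmxA wE -scalemxAl.
case E: (odd (\rank T)).
  by apply: (stable_case T) => // i; rewrite -comT submxMl.
apply: (stable_case (kermx T)) => [||i].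
- by rewrite mxrank_ker oddB ?E ?oddN // ltnW.
- by rewrite mxrank_ker ltn_subrL T_gt0.
- by apply/sub_kermxP; rewrite -mulmxA comT mulmxA mulmx_ker mul0mx.
Qed.

(** * Specialization of commuting matrices at a point of the line *)

Definition quad (R : comNzRingType) (n N : nat) (g : 'I_n -> 'I_n -> 'I_n -> R)
    (X : 'I_n -> 'M[R]_N) (i : 'I_n) : 'M[R]_N :=
  \sum_j \sum_k g i j k *: (X j *m X k).

Lemma map_quad (R S : comNzRingType) (f : {rmorphism R -> S}) (n N : nat)
    (g : 'I_n -> 'I_n -> 'I_n -> R) (X : 'I_n -> 'M[R]_N) i :
  map_mx f (quad g X i) =
  quad (fun i j k => f (g i j k)) (fun i => map_mx f (X i)) i.
Proof.
rewrite /quad raddf_sum; apply: eq_bigr => j _; rewrite raddf_sum.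
by apply: eq_bigr => k _; rewrite /= map_mxZ map_mxM.
Qed.

Section Intertwining.
Variables (R : comNzRingType) (n M N : nat) (a : R).
Variables (X : 'I_n -> 'M[R]_M) (X' : 'I_n -> 'M[R]_N).
Variables (P : 'M[R]_(M, N)) (Q : 'M[R]_N).
Hypothesis QX' : forall i, Q *m X' i = X' i *m Q.
Hypothesis XP : forall i, a *: (X i *m P) = P *m X' i *m Q.

(** Over fractions, [P] intertwines [X i] with [X' i *m Q] divided by [a]; an expression homogeneous
    of degree d in the matrices is then transported with d factors [a] and [Q]. The degrees 1, 2 and
    3 serve for linear combinations, for commutation and for the relations
    [X i *m quad g X j = X j *m quad g X i]. *)
Lemma intertwine_lin (c : 'I_n -> R) :
  a *: ((\sum_i c i *: X i) *m P) = P *m (\sum_i c i *: X' i) *m Q.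
Proof.
rewrite mulmx_suml mulmx_sumr mulmx_suml scaler_sumr; apply: eq_bigr => i _.
by rewrite -scalemxAl scalerA mulrC -scalerA XP -scalemxAr -scalemxAl.
Qed.

Lemma intertwine2 i j :
  a ^+ 2 *: (X i *m X j *m P) = P *m (X' i *m X' j) *m (Q *m Q).
Proof.
rewrite expr2 -scalerA -mulmxA scalemxAr XP !mulmxA 2!scalemxAl XP.
by rewrite -!mulmxA (mulmxA Q) QX' !mulmxA.
Qed.

Lemma intertwine_cubic (g : 'I_n -> 'I_n -> 'I_n -> R) i j :
  a ^+ 3 *: (X i *m quad g X j *m P) =
  P *m (X' i *m quad g X' j) *m (Q *m Q *m Q).
Proof.
have Qquad : Q *m quad g X' j = quad g X' j *m Q.
  rewrite /quad mulmx_sumr mulmx_suml; apply: eq_bigr => k _.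
  rewrite mulmx_sumr mulmx_suml; apply: eq_bigr => l _.
  by rewrite -scalemxAr -scalemxAl mulmxA QX' -!mulmxA QX'.
have quadP : a ^+ 2 *: (quad g X j *m P) = P *m quad g X' j *m (Q *m Q).
  rewrite /quad mulmx_suml scaler_sumr mulmx_sumr mulmx_suml.
  apply: eq_bigr => k _; rewrite mulmx_suml scaler_sumr mulmx_sumr mulmx_suml.
  apply: eq_bigr => l _; rewrite -scalemxAl scalerA mulrC -scalerA intertwine2.
  by rewrite -scalemxAr -scalemxAl.
rewrite exprS -scalerA -mulmxA scalemxAr quadP !mulmxA 3!scalemxAl XP.
by rewrite -!mulmxA (mulmxA Q) Qquad !mulmxA.
Qed.

End Intertwining.

Lemma scale_mulmx_eq0 (R : idomainType) (M N : nat) (s : R) (A : 'M[R]_(M, N))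
    (G : 'M[R]_N) : s != 0 -> \det G != 0 -> s *: (A *m G) = 0 -> A = 0.
Proof.
move=> s0 G0 /(congr1 (mulmx^~ (\adj G))).
rewrite mul0mx -scalemxAl -mulmxA mul_mx_adj mul_mx_scalar scalerA.
move/matrixP => H; apply/matrixP => i j; move: (H i j); rewrite !mxE.
by move/eqP; rewrite !mulf_eq0 (negbTE s0) (negbTE G0) => /eqP.
Qed.

Lemma Gauss_XsubC_dvdp (F : fieldType) (a : F) (k : nat) (p q : {poly F}) :
  p.[a] != 0 -> ('X - a%:P) ^+ k %| p * q -> ('X - a%:P) ^+ k %| q.
Proof.
move=> pa; rewrite Gauss_dvdpr // coprimep_expl //.
by rewrite coprimep_sym coprimep_XsubC.
Qed.

(** Picks an element of [S] vanishing to the least order [k] at [a], by descent on the order. It is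
    applied to determinants of linear combinations and of lattice bases. *)
Lemma min_multiplicity (F : fieldType) (a : F) (S : {poly F} -> Prop) p0 :
  S p0 -> p0 != 0 ->
  exists k p, [/\ p.[a] != 0, S (('X - a%:P) ^+ k * p)
    & forall q, S q -> ('X - a%:P) ^+ k %| q].
Proof.
have [k [q]] := multiplicity_XsubC p0 a.
move=> + p0E Sp0 p0_neq0; rewrite p0_neq0 /= => qa.
rewrite {p0 p0_neq0}p0E in Sp0.
elim/ltn_ind: k q qa Sp0 => k IHk q qa Sk.
have [dvdk|] := classic (forall q, S q -> ('X - a%:P) ^+ k %| q).
  by exists k, q; split=> //; rewrite mulrC.
move/not_all_ex_not=> [r nr]; have [Sr /negP ndvd] := imply_to_and _ _ nr.
have r_neq0 : r != 0 by apply: contraNneq ndvd => ->; rewrite dvdp0.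
have [l [s]] := multiplicity_XsubC r a; rewrite r_neq0 /= => sa rE.
have [lt_lk|le_kl] := ltnP l k; first by apply: (IHk l lt_lk s); rewrite -?rE.
by rewrite rE dvdp_mull // dvdp_exp2l in ndvd.
Qed.

Lemma dvdp_coef_of_values (F : fieldType) (d : {poly F}) (q : {poly {poly F}}) :
  (forall p : {poly F}, (forall x, p.[x] = 0) -> p = 0) ->
  (forall s : F, d %| q.[s%:P]) -> forall j, d %| q`_j.
Proof.
move=> infF dq j.
have modsum (I : finType) (G : I -> {poly F}) :
    (\sum_i G i) %% d = \sum_i (G i %% d).
  by apply: (big_morph (fun p => p %% d) (modpD d) (mod0p d)).
apply/eqP/polyP => l; rewrite coef0.
(* Reduction modulo [d] is [F]-linear, so the [l]-th coefficient of the remainder of [q.[s%:P]] is a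
   polynomial in [s]; it vanishes on all of [F]. *)
have /infF/polyP/(_ j) : forall s : F,
    (\poly_(j < size q) (q`_j %% d)`_l).[s] = 0.
  move=> s; rewrite horner_poly.
  have /modp_eq0P := dq s; rewrite horner_coef modsum => /polyP/(_ l).
  rewrite coef_sum coef0 => Hs; rewrite -[RHS]Hs; apply: eq_bigr => i _.
  by rewrite -polyC_exp [_ * _%:P]mulrC mul_polyC modpZl coefZ mulrC.
rewrite coef_poly coef0; case: ltnP => // /leq_sizeP/(_ _ (leqnn _)) -> _.
by rewrite mod0p coef0.
Qed.

Definition mxword (R : comNzRingType) (n N : nat) (Z : 'I_n -> 'M[R]_N)
    (w : seq 'I_n) : 'M[R]_N :=
  foldr (fun i M => Z i *m M) 1%:M w.

(** The hypothesis says that the characteristic polynomial of [Z / t] has coefficients in [R]. By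
    Cayley-Hamilton all powers of [Z / t] are combinations of the first [N] ones, so [t ^+ N] is a
    common denominator. *)
Lemma charpoly_power_bound (R : comNzRingType) (N : nat) (Z : 'M[R]_N) (t : R) :
  (forall j, (j < N)%N -> exists y, (char_poly Z)`_j = t ^+ (N - j) * y) ->
  forall a, exists M, t ^+ N *: iter a (mulmx Z) 1%:M = t ^+ a *: M.
Proof.
case: N Z => [|N] Z chiZ a; first by exists 0; rewrite [LHS]flatmx0 scaler0.
have iterE b : iter b (mulmx Z) 1%:M = Z ^+ b.
  by elim: b => //= b ->; rewrite exprS.
have ZN : Z ^+ N.+1 = - \sum_(j < N.+1) (char_poly Z)`_j *: Z ^+ j.
  have chiE : char_poly Z = \sum_(j < N.+1) (char_poly Z)`_j *: 'X^j + 'X^(N.+1).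
    rewrite -[LHS]coefK size_char_poly poly_def big_ord_recr /=.
    have /monicP := char_poly_monic Z; rewrite lead_coefE size_char_poly /=.
    by move=> ->; rewrite scale1r.
  have /eqP := Cayley_Hamilton Z; rewrite {1}chiE rmorphD rmorphXn /=.
  rewrite horner_mx_X addrC addr_eq0 => /eqP ->; rewrite rmorph_sum.
  by congr (- _); apply: eq_bigr => j _; rewrite /= linearZ rmorphXn /= horner_mx_X.
rewrite iterE; elim/ltn_ind: a => a IHa.
have [le_aN|lt_Na] := leqP a N.+1.
  by exists (t ^+ (N.+1 - a) *: Z ^+ a); rewrite scalerA -exprD subnKC.
have [b aE] : exists b, a = (N.+1 + b)%N.
  by exists (a - N.+1)%N; rewrite subnKC // ltnW.
suff [M ME] : exists M,
    t ^+ N.+1 *: \sum_(j < N.+1) (char_poly Z)`_j *: Z ^+ (j + b) = t ^+ a *: M.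
  exists (- M); rewrite scalerN -ME aE exprD ZN mulNr scalerN mulr_suml.
  by congr (- (_ *: _)); apply: eq_bigr => j _; rewrite exprD scalerAl.
have [j|y yE] := @fin_all_exists 'I_N.+1 _
  (fun j y => (char_poly Z)`_j = t ^+ (N.+1 - j) * y).
  exact: chiZ.
have [j|M ME] := @fin_all_exists 'I_N.+1 _
  (fun j M => t ^+ N.+1 *: Z ^+ (j + b) = t ^+ (j + b) *: M).
  by apply: IHa; rewrite aE ltn_add2r.
exists (\sum_j y j *: M j); rewrite !scaler_sumr; apply: eq_bigr => j _.
rewrite scalerA mulrC -scalerA ME yE !scalerA; congr (_ *: _).
have -> : a = (N.+1 - j + (j + b))%N by rewrite addnA subnK // ltnW.
by rewrite [t ^+ (_ + (j + b))]exprD mulrAC.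
Qed.

(** By commutation a word can be sorted into a product of powers, one for each letter; the
    denominators of these powers multiply. The induction is on the list of allowed letters. *)
Lemma mxword_bound (R : comNzRingType) (n N : nat) (Z : 'I_n -> 'M[R]_N)
    (t : R) (m : nat) :
  (forall i j, Z i *m Z j = Z j *m Z i) ->
  (forall i a, exists M, t ^+ m *: iter a (mulmx (Z i)) 1%:M = t ^+ a *: M) ->
  exists m', forall w, exists M, t ^+ m' *: mxword Z w = t ^+ size w *: M.
Proof.
move=> comZ powZ.
suff [m' H] : exists m', forall w : seq 'I_n, {subset w <= enum 'I_n} ->
    exists M, t ^+ m' *: mxword Z w = t ^+ size w *: M.
  by exists m' => w; apply: H => i _; rewrite mem_enum.
elim: (enum 'I_n) => [|i s [m' IHs]].
  exists 0%N => -[|j w] sub; first by exists 1%:M.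
  by have := sub j (mem_head _ _).
exists (m + m')%N => w sub.
have comM u : Z i *m mxword Z u = mxword Z u *m Z i.
  elim: u => [|j u IHu] /=; first by rewrite mulmx1 mul1mx.
  by rewrite mulmxA comZ -mulmxA IHu mulmxA.
have [b [u [us ub uE]]] : exists b u, [/\ {subset u <= s},
    size w = (b + size u)%N
    & mxword Z w = iter b (mulmx (Z i)) 1%:M *m mxword Z u].
  elim: w sub => [|j w IHw] sub.
    by exists 0%N, [::]; split=> //=; rewrite mul1mx.
  have [k kw|b [u [us ub uE]]] := IHw _.
    by apply: sub; rewrite inE kw orbT.
  have := sub j (mem_head _ _); rewrite inE; have [-> _|_ /= js] := eqVneq j i.
    exists b.+1, u; split=> //=; first by rewrite ub.
    by rewrite uE mulmxA.
  exists b, (j :: u); split=> [k|/=|/=].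
  - by rewrite inE => /predU1P[->|/us].
  - by rewrite ub addnS.
  rewrite uE !mulmxA; congr (_ *m _).
  elim: {ub uE} b => [|b IHb] /=; first by rewrite mulmx1 mul1mx.
  by rewrite mulmxA comZ -mulmxA IHb mulmxA.
have [M ME] := powZ i b; have [M' ME'] := IHs u us.
exists (M *m M'); rewrite uE ub !exprD -!scalerA scalemxAr ME' -scalemxAr.
have -> (I : 'M[R]_N) : t ^+ m *: (t ^+ size u *: (I *m M')) =
    t ^+ size u *: ((t ^+ m *: I) *m M').
  by rewrite -scalemxAl !scalerA mulrC.
by rewrite ME -scalemxAl !scalerA mulrC.
Qed.

Lemma coef_comp_polyZX (R : comNzRingType) (p : {poly R}) (c : R) j :
  (p \Po (c *: 'X))`_j = p`_j * c ^+ j.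
Proof.
have -> : p \Po (c *: 'X) = \poly_(i < size p) (p`_i * c ^+ i).
  rewrite comp_polyE poly_def; apply: eq_bigr => i _.
  by rewrite exprZn scalerA.
by rewrite coef_poly; case: ltnP => // /leq_sizeP-> //; rewrite mul0r.
Qed.

(* In other words, [A *m invmx B] is integral over the local ring at [a]. *)
Lemma dvd_charpoly_mul_adj (F : fieldType) (a : F) (k N : nat)
    (A B : 'M[{poly F}]_N) (d : {poly F}) :
  (forall p : {poly F}, (forall x, p.[x] = 0) -> p = 0) ->
  d.[a] != 0 -> \det B = ('X - a%:P) ^+ k * d ->
  (forall s : F, ('X - a%:P) ^+ k %| \det (s%:P *: B - A)) ->
  forall j, (j < N)%N ->
  exists y, (char_poly (A *m \adj B))`_j = (('X - a%:P) ^+ k) ^+ (N - j) * y.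
Proof.
move=> infF da detB dvdB j lt_jN.
set t := ('X - a%:P) ^+ k in detB dvdB *.
have t_neq0 : t != 0 by rewrite expf_neq0 // polyXsubC_eq0.
have d_neq0 : d != 0 by apply: contraNneq da => ->; rewrite horner0.
have D_neq0 : \det B != 0 by rewrite detB mulf_neq0.
pose up := map_mx (@polyC {poly F}) : 'M[{poly F}]_N -> 'M_N.
pose Delta := \det ('X *: up B - up A).
have dvdDelta : t %| Delta`_j.
  apply: dvdp_coef_of_values => // s; move: (dvdB s).
  rewrite (_ : Delta.[s%:P] = \det (s%:P *: B - A)) //.
  rewrite -[LHS]/(horner_eval s%:P Delta) /Delta -det_map_mx; congr (\det _).
  by apply/matrixP => p q; rewrite /up !mxE /= /horner_eval !hornerE.
set chi := char_poly (A *m \adj B).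
(* Because [\det B *: 'X - A *m \adj B] factors as [('X *: B - A) *m \adj B]. *)
have chiE : chi \Po (\det B *: 'X) = Delta * (\det (\adj B))%:P.
  rewrite -[LHS]/((comp_poly (\det B *: 'X)) chi) /chi /char_poly -det_map_mx.
  rewrite -det_map_mx -det_mulmx; congr (\det _).
  rewrite mulmxBl -scalemxAl -!map_mxM mul_mx_adj /char_poly_mx.
  apply/matrixP => p q; rewrite !mxE raddfB /= comp_polyC; congr (_ - _).
  rewrite raddfMn /= comp_polyX; case: eqP => _.
    by rewrite !mulr1n mulrC mul_polyC.
  by rewrite !mulr0n mulr0.
clearbody chi Delta; have chij : chi`_j * \det B ^+ j = Delta`_j * \det (\adj B).
  by rewrite -coef_comp_polyZX chiE coefMC.
have detadj : \det (\adj B) * \det B = \det B ^+ N.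
  by rewrite -det_mulmx mul_adj_mx det_scalar.
have [y yE] := dvdpP _ _ dvdDelta.
have key : d * chi`_j = t ^+ (N - j) * (d ^+ (N - j) * y).
  apply: (mulfI (mulf_neq0 t_neq0 (expf_neq0 j D_neq0))).
  transitivity (chi`_j * \det B ^+ j * \det B); first by rewrite [X in _ = _ * X]detB; ring.
  have expN : \det B ^+ N = \det B ^+ j * \det B ^+ (N - j).
    by rewrite -exprD subnKC // ltnW.
  rewrite chij -mulrA detadj yE expN.
  by rewrite (mulrA (t ^+ (N - j))) -exprMn -detB; ring.
have : t ^+ (N - j) %| d * chi`_j by rewrite key dvdp_mulr.
rewrite /t -exprM => /(Gauss_XsubC_dvdp da)/dvdpP[z ->]; exists z.
by rewrite mulrC.
Qed.

Lemma row_mul_adj (R : comNzRingType) (N : nat) (G : 'M[R]_N) (v : 'rV[R]_N) j :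
  (v *m \adj G) 0 j = \det (\matrix_(i, l) if i == j then v 0 l else G i l).
Proof.
rewrite (expand_det_row _ j) !mxE; apply: eq_bigr => l _.
rewrite !mxE eqxx; congr (_ * (_ * \det _)); apply/matrixP => p q.
by rewrite !mxE eq_sym (negbTE (neq_lift _ _)).
Qed.

(* Among the matrices whose rows lie in the lattice of vectors [v] with
   [t ^ size w] dividing [v *m mxword Z w] for all [w], one whose determinant
   vanishes to the least order at [a] is, by Cramer's rule, a basis of this
   lattice over the local ring at [a]. *)
Lemma stable_lattice (F : fieldType) (a : F) (k n N m : nat)
    (Z : 'I_n -> 'M[{poly F}]_N) :
  (forall w, exists M, (('X - a%:P) ^+ k) ^+ m *: mxword Z w
    = (('X - a%:P) ^+ k) ^+ size w *: M) ->
  exists G g C, [/\ \det G != 0, g.[a] != 0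
    & forall i, ('X - a%:P) ^+ k *: (C i *m G) = g *: (G *m Z i)].
Proof.
set t := ('X - a%:P) ^+ k => boundZ.
have t_neq0 : t != 0 by rewrite expf_neq0 // polyXsubC_eq0.
pose lat (v : 'rV[{poly F}]_N) :=
  forall w, exists v', v *m mxword Z w = t ^+ size w *: v'.
pose S d := exists2 G : 'M_N, (forall i, lat (row i G)) & d = \det G.
(* By the bound on words, [t ^+ m] times the standard basis lies in the lattice; this gives a
   nonzero determinant to start from. *)
have St : S (\det ((t ^+ m)%:M : 'M_N)).
  exists (t ^+ m)%:M => // i w; have [M ME] := boundZ w.
  by exists (row i M); rewrite -row_mul mul_scalar_mx ME linearZ.
have [|mu [g [ga [G latG detG] minG]]] := min_multiplicity a St.
  by rewrite det_scalar expf_neq0 // expf_neq0.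
have g_neq0 : g != 0 by apply: contraNneq ga => ->; rewrite horner0.
have pi_neq0 : ('X - a%:P) ^+ mu != 0 by rewrite expf_neq0 // polyXsubC_eq0.
have G_neq0 : \det G != 0 by rewrite -detG mulf_neq0.
have coordG v : lat v -> exists c, g *: v = c *m G.
  move=> latv.
  (* By Cramer's rule this entry is the determinant of [G] with row [j] replaced by [v]. The rows
     still lie in the lattice, so minimality applies. *)
  have dvdv j : ('X - a%:P) ^+ mu %| (v *m \adj G) 0 j.
    rewrite row_mul_adj; apply: minG; eexists; last by [].
    move=> i; have [->|ne_ij] := eqVneq i j.
      rewrite (_ : row j _ = v) //; apply/rowP => l.
      by rewrite !mxE eqxx.
    rewrite (_ : row i _ = row i G) //; apply/rowP => l.
    by rewrite !mxE (negbTE ne_ij).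
  have [c cE] := fin_all_exists (fun j => dvdpP _ _ (dvdv j)).
  exists (\row_j c j).
  have vadj : v *m \adj G = ('X - a%:P) ^+ mu *: \row_j c j.
    by apply/rowP => j; rewrite cE !mxE mulrC.
  have := congr1 (mulmx^~ G) vadj.
  rewrite -mulmxA mul_adj_mx mul_mx_scalar -detG -scalerA -scalemxAl.
  move/rowP => H; apply/rowP => j; move: (H j); rewrite !mxE.
  exact: mulfI.
(* The lattice is stable under [Z i / t]: prefixing a word by [i] costs exactly one factor [t]. *)
have rowC i l : exists c, t *: (c *m G) = g *: row l (G *m Z i).
  have [v vE] := latG l [:: i]; rewrite /= mulmx1 expr1 in vE.
  have [w|c cE] := coordG v.
    have [v' v'E] := latG l (i :: w); exists v'.
    rewrite /= mulmxA vE exprS -scalerA -scalemxAl in v'E.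
    move/rowP: v'E => v'E; apply/rowP => j; move: (v'E j); rewrite !mxE.
    exact: mulfI.
  by exists c; rewrite -cE row_mul vE !scalerA mulrC.
have [C CE] := fin_all_exists (fun i => fin_all_exists (rowC i)).
exists G, g, (fun i => \matrix_l C i l); split=> // i.
by apply/row_matrixP => l; rewrite !linearZ /= row_mul rowK CE.
Qed.

Lemma specialize_commuting (F : fieldType) (a : F) (n N : nat)
    (A : 'I_n -> 'M[{poly F}]_N) (g : 'I_n -> 'I_n -> 'I_n -> {poly F})
    (c0 : 'I_n -> F) :
  (forall p : {poly F}, (forall x, p.[x] = 0) -> p = 0) ->
  (forall i j, A i *m A j = A j *m A i) ->
  (forall i j, A i *m quad g A j = A j *m quad g A i) ->
  \det (\sum_i (c0 i)%:P *: A i) != 0 ->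
  exists C : 'I_n -> 'M[F]_N, [/\ forall i j, C i *m C j = C j *m C i,
    forall i j, C i *m quad (fun i j k => (g i j k).[a]) C j =
      C j *m quad (fun i j k => (g i j k).[a]) C i
    & exists c e, e != 0 /\ \sum_i c i *: C i = e%:M].
Proof.
move=> infF comA quadA det0.
pose S d := exists c : 'I_n -> F, \det (\sum_i (c i)%:P *: A i) = d.
have [|k [d [da [c]]]] := @min_multiplicity F a S _ _ det0; first by exists c0.
set t := ('X - a%:P) ^+ k; set B := \sum_i _ => detB minB.
have t_neq0 : t != 0 by rewrite expf_neq0 // polyXsubC_eq0.
have d_neq0 : d != 0 by apply: contraNneq da => ->; rewrite horner0.
have B_neq0 : \det B != 0 by rewrite detB mulf_neq0.
(* [s%:P *: B - A i] is again a combination of the [A l] with coefficients in [F], so the minimality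
   of [k] applies to it. *)
have dvdB i (s : F) : t %| \det (s%:P *: B - A i).
  apply: minB; exists (fun l => s * c l - (l == i)%:R); congr (\det _).
  rewrite /B scaler_sumr; apply/eqP; rewrite eq_sym subr_eq; apply/eqP.
  rewrite -[in RHS](scale1r (A i)) (bigD1 i) //= [in RHS](bigD1 i) //= eqxx.
  rewrite addrAC -scalerDl polyCB subrK scalerA -polyCM; congr (_ + _).
  by apply: eq_bigr => l /negbTE ->; rewrite subr0 scalerA -polyCM.
have comB i : A i *m B = B *m A i.
  rewrite /B mulmx_sumr mulmx_suml; apply: eq_bigr => l _.
  by rewrite -scalemxAl -scalemxAr comA.
have comadj i : \adj B *m A i = A i *m \adj B.
  apply/eqP; rewrite -subr_eq0; apply/eqP.
  apply: (scale_mulmx_eq0 (oner_neq0 _) B_neq0).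
  rewrite scale1r mulmxBl -!mulmxA comB mul_adj_mx mulmxA mul_adj_mx.
  by rewrite mul_mx_scalar mul_scalar_mx subrr.
(* As [\det B = t * d], the quotient [Z i / t] is [d] times [A i *m B^-1], and [d] is a unit at
   [a]. *)
pose Z i := A i *m \adj B.
have comZ i j : Z i *m Z j = Z j *m Z i.
  by rewrite /Z !mulmxA -(mulmxA (A i)) -(mulmxA (A j)) !comadj !mulmxA comA.
have powZ i b : exists M, t ^+ N *: iter b (mulmx (Z i)) 1%:M = t ^+ b *: M.
  apply: charpoly_power_bound => j lt_jN.
  by apply: (@dvd_charpoly_mul_adj _ _ _ _ _ _ d).
have [m boundZ] := mxword_bound comZ powZ.
have [G [q [C [G_neq0 qa CG]]]] := stable_lattice boundZ.
pose Q := q *: \adj B.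
have QA i : Q *m A i = A i *m Q by rewrite -scalemxAl comadj scalemxAr.
have CQ i : t *: (C i *m G) = G *m A i *m Q.
  by rewrite CG /Z -scalemxAr mulmxA.
have q_neq0 : q != 0 by apply: contraNneq qa => ->; rewrite horner0.
have comC i j : C i *m C j = C j *m C i.
  apply/eqP; rewrite -subr_eq0; apply/eqP.
  apply: (scale_mulmx_eq0 (expf_neq0 2 t_neq0) G_neq0).
  rewrite mulmxBl scalerBr !(intertwine2 QA CQ) comA; exact: subrr.
have quadC i j : C i *m quad g C j = C j *m quad g C i.
  apply/eqP; rewrite -subr_eq0; apply/eqP.
  apply: (scale_mulmx_eq0 (expf_neq0 3 t_neq0) G_neq0).
  rewrite mulmxBl scalerBr !(intertwine_cubic QA CQ) quadA; exact: subrr.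
(* Over fractions [C i] is conjugate to [q * d] times [A i *m B^-1], and [B] is the combination of
   the [A i] with coefficients [c]. As [(q * d).[a]] is nonzero, the specialized matrices cannot all
   be nilpotent. *)
have linC : \sum_i (c i)%:P *: C i = (q * d)%:M.
  apply/eqP; rewrite -subr_eq0; apply/eqP.
  apply: (scale_mulmx_eq0 t_neq0 G_neq0).
  rewrite mulmxBl scalerBr (intertwine_lin CQ) -/B -mulmxA -scalemxAr.
  rewrite mul_mx_adj detB mul_scalar_mx -scalemxAr mul_mx_scalar !scalerA.
  by rewrite mulrCA subrr.
exists (fun i => map_mx (horner_eval a) (C i)); split=> [i j|i j|].
- by rewrite -!map_mxM comC.
- by rewrite -!(map_quad (horner_eval a)) -!map_mxM quadC.
exists c, (q * d).[a]; split; first by rewrite hornerM mulf_neq0.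
have := congr1 (map_mx (horner_eval a)) linC.
rewrite map_scalar_mx raddf_sum => <-; apply: eq_bigr => i _.
by rewrite /= map_mxZ /= /horner_eval hornerC.
Qed.

(** * The deformation of the squaring map *)

(** The fixed points of the deformed map, with [h] standing for the given map minus the
    coordinatewise squares. They are power series in general, so a target ring [R] is allowed: [rho]
    will be reduction modulo a power of ['X], or evaluation at 0. *)
Definition deformed_idempotent (F : fieldType) (n : nat)
    (h : 'I_n -> 'I_n -> 'I_n -> F) (R : comNzRingType)
    (rho : {rmorphism {poly F} -> R}) (x : 'I_n -> R) : Prop :=
  forall i, x i ^+ 2 =
    x i - rho 'X * \sum_j \sum_k rho (h i j k)%:P * (x j * x k).

(* Modulo X the Jacobian of the system at the 0/1 vector of [e] is diagonal with
   entries [s i] = 1 or -1, so Newton's iteration converges X-adically. *)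
Lemma newton_points (F : fieldType) (n : nat) (h : 'I_n -> 'I_n -> 'I_n -> F)
    (e : {set 'I_n}) (r : nat) :
  exists x : 'I_n -> {poly F}, (forall i, 'X %| x i - (i \in e)%:R) /\
    forall i, 'X^(r.+1) %|
      x i ^+ 2 - x i + 'X * \sum_j \sum_k (h i j k)%:P * (x j * x k).
Proof.
elim: r => [|r [x [x0 xr]]].
  exists (fun i => (i \in e)%:R); split=> i; first by rewrite subrr dvdp0.
  by case: (i \in e); rewrite ?expr1n ?expr0n subrr add0r dvdp_mulr.
pose y i := x i ^+ 2 - x i + 'X * \sum_j \sum_k (h i j k)%:P * (x j * x k).
pose s i : {poly F} := (i \in e)%:R *+ 2 - 1.
have s2 i : s i * s i = 1 by rewrite /s; case: (i \in e) => /=; ring.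
have dvdy i : 'X^(r.+1) %| y i by apply: xr.
have dvdXy i : 'X %| y i.
  by apply: dvdp_trans (dvdy i); rewrite exprS dvdp_mulr.
exists (fun i => x i - s i * y i); split=> i.
  by rewrite addrAC dvdp_sub // dvdp_mull.
(* The linear terms cancel as [s i * s i = 1]. What is left is divisible by ['X^(r.+2)]: each [y]
   gives ['X^(r.+1)], and its cofactor or the prefactor ['X] gives one more ['X]. *)
have -> : (x i - s i * y i) ^+ 2 - (x i - s i * y i) +
    'X * (\sum_j \sum_k (h i j k)%:P *
            ((x j - s j * y j) * (x k - s k * y k))) =
    y i * (y i - (x i - (i \in e)%:R) * s i *+ 2) +
    'X * (\sum_j \sum_k (h i j k)%:P *
            (s j * s k * y k * y j - s j * x k * y j - s k * x j * y k)).
  have alg (z x1 y1 s1 e1 S1 S2 : {poly F}) :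
      s1 * s1 = 1 -> s1 = e1 *+ 2 - 1 -> y1 = x1 ^+ 2 - x1 + z * S1 ->
      (x1 - s1 * y1) ^+ 2 - (x1 - s1 * y1) + z * (S1 + S2) =
      y1 * (y1 - (x1 - e1) * s1 *+ 2) + z * S2.
    move=> s1s1 s1E y1E.
    have -> : z * (S1 + S2) = y1 - x1 ^+ 2 + x1 + z * S2 by rewrite y1E; ring.
    have e1s1 : e1 * s1 *+ 2 = 1 + s1 by rewrite -s1s1 s1E; ring.
    transitivity (y1 + s1 * s1 * (y1 * y1) - x1 * s1 * y1 *+ 2 + s1 * y1 + z * S2).
      by ring.
    transitivity (y1 * (y1 - x1 * s1 *+ 2 + e1 * s1 *+ 2) + z * S2).
      by rewrite s1s1 e1s1; ring.
    by ring.
  rewrite -(alg _ _ _ _ _ (\sum_j \sum_k (h i j k)%:P * (x j * x k))) //.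
  congr (_ + _ * _); rewrite -big_split; apply: eq_bigr => j _ /=.
  by rewrite -big_split; apply: eq_bigr => k _ /=; ring.
rewrite dvdp_add //.
  rewrite exprSr dvdp_mul // dvdp_sub // mulr2n dvdp_add ?dvdp_mulr //.
rewrite exprS dvdp_mul //.
apply: (big_ind (fun p => 'X^(r.+1) %| p)) => [|p q|j _]; first exact: dvdp0.
  exact: dvdp_add.
apply: (big_ind (fun p => 'X^(r.+1) %| p)) => [|p q|k _]; first exact: dvdp0.
  exact: dvdp_add.
by rewrite dvdp_mull // !dvdp_sub // dvdp_mull.
Qed.

Lemma not_uniq_perm (T : eqType) (w : seq T) :
  ~~ uniq w -> exists i w', perm_eq w (i :: i :: w').
Proof.
elim: w => //= j w IHw; rewrite negb_and negbK.
have [jw _|_ /= /IHw[i [w' pw]]] := boolP (j \in w).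
  by exists j, (rem j w); rewrite perm_cons perm_to_rem.
exists i, (j :: w'); apply: perm_trans (_ : perm_eq _ (j :: i :: i :: w')) _.
  by rewrite perm_cons.
by rewrite -[j :: i :: _]/([:: j] ++ [:: i; i] ++ w') perm_catCA.
Qed.

(** A finite type for the words of length 1 to [n.+1], so that they can index sums and matrices. *)
Definition short_word (n : nat) (t : 'I_n * n.-bseq 'I_n) : seq 'I_n :=
  t.1 :: t.2.

Lemma short_wordP (n : nat) (w : seq 'I_n) :
  (0 < size w <= n.+1)%N -> exists t, short_word t = w.
Proof. by case: w => // i w /= lt_wn; exists (i, Bseq lt_wn). Qed.

Lemma short_word_inj (n : nat) : injective (@short_word n).
Proof. by move=> [i w] [j u] [/= -> /val_inj ->]. Qed.

(** A repeated letter [i] is removed by the equation for [x i ^+ 2]: the term [x i] shortens the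
    word, and the others keep its length and carry a factor ['X]. The coefficients [q] are chosen
    before [R], [rho] and [x]. *)
Lemma reduce_word (F : fieldType) (n : nat) (h : 'I_n -> 'I_n -> 'I_n -> F)
    (w : seq 'I_n) :
  (0 < size w <= n.+1)%N ->
  exists q : 'I_n * n.-bseq 'I_n -> {poly F},
    forall (R : comNzRingType) (rho : {rmorphism {poly F} -> R}) x,
    deformed_idempotent h rho x ->
    \prod_(i <- w) x i = \prod_(i in [set i in w]) x i +
      rho 'X * \sum_t rho (q t) * \prod_(i <- short_word t) x i.
Proof.
have [m] := ubnP (size w); elim: m w => // m IHm w.
rewrite ltnS => le_wm size_w.
have [uniq_w|] := boolP (uniq w).
  exists (fun=> 0) => R rho x _; rewrite [X in _ * X]big1 => [|t _]; last first.
    by rewrite /= rmorph0 mul0r.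
  rewrite mulr0 addr0 big_uniq //=; apply: eq_bigl => i.
  by rewrite inE.
move/not_uniq_perm=> [i [w' pw]].
have sw := perm_size pw; rewrite /= in sw.
have [le0w le_wn] := andP size_w.
have [||q qE] := IHm (i :: w'); first by rewrite /= -sw.
  by rewrite /= ltnS ltnW // -ltnS -sw.
have wE : [set j in w] = [set j in i :: w'].
  by apply/setP => j; rewrite !inE (perm_mem pw) !inE orbA orbb.
exists (fun t => q t - \sum_j \sum_k
  (h i j k)%:P *+ (short_word t == [:: j, k & w'])) => R rho x solx.
rewrite (perm_big _ pw) /= wE !big_cons mulrA -expr2 solx.
have := qE R rho x solx; rewrite big_cons => xw.
rewrite mulrBl xw -addrA; congr (_ + _).
rewrite -mulrA -mulrBr; congr (_ * _).
under [in RHS]eq_bigr do rewrite rmorphB mulrBl.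
rewrite sumrB; congr (_ - _).
transitivity (\sum_t \sum_j \sum_k rho (h i j k)%:P *
    ((short_word t == [:: j, k & w'])%:R * \prod_(l <- short_word t) x l)).
  rewrite [RHS]exchange_big mulr_suml; apply: eq_bigr => j _.
  rewrite [RHS]exchange_big mulr_suml; apply: eq_bigr => k _ /=.
  rewrite -mulr_sumr -!mulrA; congr (_ * _).
  have [|t tE] := @short_wordP n [:: j, k & w'].
    by rewrite /= -sw le_wn.
  rewrite (bigD1 t) //= tE eqxx mul1r !big_cons [X in _ + X]big1 ?addr0 ?mulrA //.
  move=> u ne_ut; rewrite -tE (inj_eq (@short_word_inj n)) (negbTE ne_ut).
  by rewrite mul0r.
apply: eq_bigr => t _; rewrite rmorph_sum mulr_suml; apply: eq_bigr => j _.
rewrite rmorph_sum mulr_suml; apply: eq_bigr => k _.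
by rewrite mulrA /= rmorphMn mulr_natr.
Qed.

(* By [reduce_word] the vector [v] of the monomials of degree 1 to [n.+1] solves
   [(1 - 'X *: M) *m v = v0] with [v0] squarefree; [u] is the determinant of this
   system. *)
Lemma reduce_to_squarefree (F : fieldType) (n : nat)
    (h : 'I_n -> 'I_n -> 'I_n -> F) :
  exists u : {poly F}, u.[0] = 1 /\
    forall w : seq 'I_n, (0 < size w <= n.+1)%N ->
    exists c : {set 'I_n} -> {poly F},
      forall (R : comNzRingType) (rho : {rmorphism {poly F} -> R}) x,
      deformed_idempotent h rho x ->
      rho u * \prod_(i <- w) x i =
        \sum_(b in [set~ set0]) rho (c b) * \prod_(i in b) x i.
Proof.
have [t|Q QE] := fin_all_exists (fun t => @reduce_word F n h (@short_word n t) _).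
  by rewrite /= ltnS size_bseq.
set K := #|{: 'I_n * n.-bseq 'I_n}|.
pose M : 'M[{poly F}]_K := \matrix_(i, j) Q (enum_val i) (enum_val j).
pose U := 1%:M - 'X *: M.
exists (\det U); split.
  rewrite -[LHS]/(horner_eval 0 (\det U)) -det_map_mx -[RHS](det1 F K).
  congr (\det _); apply/matrixP => i j.
  rewrite !mxE /= /horner_eval !hornerE subr0.
  by case: eqP => _; rewrite ?hornerC ?horner0.
move=> w /short_wordP[t <-].
exists (fun b => \sum_(j | [set i in short_word (enum_val j)] == b)
  \adj U (enum_rank t) j) => R rho x solx.
pose v : 'cV[R]_K := \col_i \prod_(l <- short_word (enum_val i)) x l.
pose v0 : 'cV[R]_K :=
  \col_i \prod_(l in [set l in short_word (enum_val i)]) x l.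
have Uv : map_mx rho U *m v = v0.
  rewrite map_mxB map_mx1 map_mxZ mulmxBl mul1mx -scalemxAl.
  apply/eqP; rewrite subr_eq; apply/eqP/colP => i.
  rewrite [LHS]mxE (QE _ _ _ _ solx) !mxE; congr (_ + _ * _).
  under [in RHS]eq_bigr do rewrite !mxE.
  by rewrite (big_enum_val (fun s => rho (Q (enum_val i) s) *
    \prod_(l <- short_word s) x l)).
have := congr1 (mulmx (map_mx rho (\adj U))) Uv.
rewrite mulmxA -map_mxM mul_adj_mx map_scalar_mx mul_scalar_mx.
move/colP/(_ (enum_rank t)); rewrite !mxE enum_rankK => ->.
transitivity (\sum_(j < K) rho (\adj U (enum_rank t) j) *
    \prod_(l in [set l in short_word (enum_val j)]) x l).
  by apply: eq_bigr => j _; rewrite !mxE.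
rewrite (partition_big (fun j : 'I_K => [set l in short_word (enum_val j)])
  (mem [set~ set0])) /=; last first.
  move=> j _; rewrite !inE; apply/set0Pn; exists (enum_val j).1.
  by rewrite !inE eqxx.
apply: eq_bigr => b _; rewrite rmorph_sum mulr_suml.
by apply: eq_bigr => j /eqP <-.
Qed.

Definition nonempty_set (n : nat) (a : 'I_#|[set~ (set0 : {set 'I_n})]|) :
  {set 'I_n} := enum_val a.

(** Evaluation of the nonconstant squarefree monomials (rows) at the points (columns), where [x e]
    is the point deforming the indicator vector of [e]. In the basis of points, multiplication by a
    coordinate is [point_diag]. *)
Definition point_matrix (R : comNzRingType) (n : nat)
    (x : {set 'I_n} -> 'I_n -> R) : 'M[R]_#|[set~ (set0 : {set 'I_n})]| :=
  \matrix_(a, e) \prod_(i in nonempty_set a) x (nonempty_set e) i.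

Definition point_diag (R : comNzRingType) (n : nat)
    (x : {set 'I_n} -> 'I_n -> R) (i : 'I_n) :
    'M[R]_#|[set~ (set0 : {set 'I_n})]| :=
  diag_mx (\row_e x (nonempty_set e) i).

(* Row [a] of [A i] expands [u] times the product of the [i]-th coordinate and
   the squarefree monomial of [a] in the squarefree monomials. *)
Lemma multiplication_matrices (F : fieldType) (n : nat)
    (h : 'I_n -> 'I_n -> 'I_n -> F) :
  exists u A, u.[0] = 1 /\
    forall (R : comNzRingType) (rho : {rmorphism {poly F} -> R})
      (x : {set 'I_n} -> 'I_n -> R),
    (forall e, deformed_idempotent h rho (x e)) ->
    forall i : 'I_n, map_mx rho (A i) *m point_matrix x =
      point_matrix x *m point_diag x i *m (rho u)%:M.
Proof.
have [u [u0 red_u]] := reduce_to_squarefree h.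
(* A squarefree monomial has at most [n] letters and one more is multiplied in, hence the bound
   [n.+1]. *)
have word_ok i (a : 'I_#|[set~ (set0 : {set 'I_n})]|) :
    (0 < size (i :: enum (nonempty_set a)) <= n.+1)%N.
  by rewrite /= ltnS -cardE (leq_trans (max_card _)) ?card_ord.
have [c cE] := fin_all_exists (fun i =>
  fin_all_exists (fun a => red_u _ (word_ok i a))).
exists u, (fun i => \matrix_(a, b) c i a (nonempty_set b)).
split=> // R rho x solx i; apply/matrixP => a e.
rewrite mul_mx_scalar mul_mx_diag !mxE.
transitivity (rho u * \prod_(l <- i :: enum (nonempty_set a)) x (nonempty_set e) l).
  rewrite (cE i a _ _ _ (solx (nonempty_set e))) [RHS]big_enum_val.
  by apply: eq_bigr => b _; rewrite !mxE.
by rewrite big_cons big_enum /= [x _ i * _]mulrC.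
Qed.

Lemma point_diagC (R : comNzRingType) (n : nat) (x : {set 'I_n} -> 'I_n -> R)
    i j : point_diag x i *m point_diag x j = point_diag x j *m point_diag x i.
Proof.
by rewrite !mulmx_diag; congr diag_mx; apply/rowP => e; rewrite !mxE mulrC.
Qed.

(** This is the matrix of the inclusion order, unitriangular when sets are sorted by cardinality. *)
Lemma incidence_det (F : fieldType) (n : nat) :
  \det (point_matrix (fun (e : {set 'I_n}) i => (i \in e)%:R : F)) != 0.
Proof.
set P := point_matrix _.
have PE a e : P a e = (nonempty_set a \subset nonempty_set e)%:R.
  rewrite mxE; have [sub_ae|/subsetPn[i ia ie]] := boolP (_ \subset _).
    by rewrite big1 // => i /(subsetP sub_ae) ->.
  by rewrite (bigD1 i) //= (negbTE ie) mul0r.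
apply/det0P => -[v /eqP v_neq0 vP]; apply: v_neq0; apply/rowP => e; rewrite mxE.
have [m] := ubnP #|nonempty_set e|; elim: m e => // m IHm e; rewrite ltnS => le_em.
move/rowP/(_ e): vP; rewrite !mxE (bigD1 e) //= PE subxx mulr1.
rewrite big1 ?addr0 // => a ne_ae; rewrite PE.
have [sub_ae|_] := boolP (nonempty_set a \subset nonempty_set e); last by rewrite mulr0.
rewrite IHm ?mul0r // (leq_trans _ le_em) // proper_card //.
by rewrite properEneq sub_ae andbT (inj_eq enum_val_inj).
Qed.

Lemma in_qpoly_Xn_eq0 (F : fieldType) (r : nat) (p : {poly F}) :
  (in_qpoly 'X^(r.+1) p == 0) = ('X^(r.+1) %| p).
Proof.
by rewrite -val_eqE /= mk_monic_Xn dvdpE.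
Qed.

(** [\det P] is nonzero at 0, so ['X^(r.+1)] divides each entry of [M]; taking [r] to be the size of
    a nonzero entry gives a contradiction. *)
Lemma eq0_of_adic (F : fieldType) (N : nat) (M : 'M[{poly F}]_N)
    (P0 : 'M[F]_N) :
  \det P0 != 0 ->
  (forall r, exists P, map_mx (horner_eval 0) P = P0 /\
    map_mx (in_qpoly 'X^(r.+1)) (M *m P) = 0) -> M = 0.
Proof.
move=> P0_neq0 MP; apply/matrixP => i j; rewrite mxE; apply/eqP.
apply: contraT => Mij; have [P [PE]] := MP (size (M i j)).
set r := size _ => /matrixP MP0.
have dvdMP k l : 'X^(r.+1) %| (M *m P) k l.
  by rewrite -in_qpoly_Xn_eq0; have := MP0 k l; rewrite !mxE => ->.
have detP : (\det P).[0] != 0.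
  by rewrite -[_.[0]]/(horner_eval 0 (\det P)) -det_map_mx PE.
have : ('X - 0%:P) ^+ r.+1 %| \det P * M i j.
  rewrite subr0; have <- : (M *m P *m \adj P) i j = \det P * M i j.
    by rewrite -mulmxA mul_mx_adj mul_mx_scalar mxE.
  rewrite mxE; apply: (big_ind (fun p => 'X^(r.+1) %| p)) => [|p q|k _].
  - exact: dvdp0.
  - exact: dvdp_add.
  - by rewrite dvdp_mulr.
move/(Gauss_XsubC_dvdp detP)/(dvdp_leq Mij).
by rewrite subr0 size_polyXn -/r ltnNge leqnSn.
Qed.

Lemma quad_point_diag (R : comNzRingType) (n : nat)
    (g : 'I_n -> 'I_n -> 'I_n -> R) (x : {set 'I_n} -> 'I_n -> R) i :
  (forall e, \sum_j \sum_k g i j k * (x e j * x e k) = x e i) ->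
  quad g (point_diag x) i = point_diag x i.
Proof.
move=> gx; apply/matrixP => a e; rewrite summxE !mxE -gx -sumrMnl.
apply: eq_bigr => j _; rewrite summxE -sumrMnl; apply: eq_bigr => k _.
by rewrite mxE mulmx_diag !mxE mulrnAr.
Qed.

Lemma generic_commuting_family (F : fieldType) (n : nat)
    (h : 'I_n -> 'I_n -> 'I_n -> F)
    (g := fun i j k => ((j == i) && (k == i))%:R + 'X * (h i j k)%:P) :
  (forall p : {poly F}, (forall x, p.[x] = 0) -> p = 0) ->
  exists (A : 'I_n -> 'M[{poly F}]_#|[set~ (set0 : {set 'I_n})]|) c,
    [/\ forall i j, A i *m A j = A j *m A i,
        forall i j, A i *m quad g A j = A j *m quad g A i
      & \det (\sum_i (c i)%:P *: A i) != 0].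
Proof.
move=> infF; have [u [A [u0 AP]]] := multiplication_matrices h.
have gsum (R : comNzRingType) (rho : {rmorphism {poly F} -> R}) x i :
    deformed_idempotent h rho x ->
    \sum_j \sum_k rho (g i j k) * (x j * x k) = x i.
  move=> solx; transitivity (x i ^+ 2 +
      rho 'X * \sum_j \sum_k rho (h i j k)%:P * (x j * x k)); last first.
    by rewrite solx subrK.
  rewrite mulr_sumr; transitivity (\sum_j
    (\sum_k ((j == i) && (k == i))%:R * (x j * x k) +
     rho 'X * \sum_k rho (h i j k)%:P * (x j * x k))).
    apply: eq_bigr => j _; rewrite mulr_sumr -big_split; apply: eq_bigr => k _.
    by rewrite /= /g rmorphD rmorphM rmorph_nat mulrDl -!mulrA.
  rewrite big_split /=; congr (_ + _); rewrite (bigD1 i) //= (bigD1 i) //=.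
  rewrite !eqxx mul1r -expr2 !big1 ?addr0 // => [j /negbTE ne_ji|k /negbTE ->].
    by rewrite big1 // => k _; rewrite ne_ji mul0r.
  by rewrite mul0r.
have commD (R : comNzRingType) (s : R) (x : {set 'I_n} -> 'I_n -> R) i :
    s%:M *m point_diag x i = point_diag x i *m s%:M.
  by rewrite scalar_mxC.
have adic r : exists P : 'M[{poly F}]_#|[set~ (set0 : {set 'I_n})]|,
    map_mx (horner_eval 0) P =
      point_matrix (fun (e : {set 'I_n}) i => (i \in e)%:R) /\
    exists x, map_mx (in_qpoly 'X^(r.+1)) P = point_matrix x /\
      forall e, deformed_idempotent h (in_qpoly 'X^(r.+1)) (x e).
  have [y yE] := fin_all_exists (fun e => newton_points h e r).
  exists (point_matrix y); split.
    apply/matrixP => a e; rewrite !mxE rmorph_prod; apply: eq_bigr => i _.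
    have [/(_ i)/dvdpP[q /eqP]] := yE (nonempty_set e).
    rewrite subr_eq => /eqP -> _; rewrite /= /horner_eval !hornerE.
    by case: (i \in _); rewrite ?hornerC ?horner0.
  exists (fun e i => in_qpoly 'X^(r.+1) (y e i)); split.
    by apply/matrixP => a e; rewrite !mxE rmorph_prod.
  move=> e i; have [_ /(_ i)] := yE e; rewrite -in_qpoly_Xn_eq0.
  rewrite rmorphD rmorphB rmorphXn rmorphM rmorph_sum /= => /eqP.
  move/(canRL (addrK _)); rewrite sub0r => /(canRL (subrK _)) ->.
  rewrite addrC; congr (_ - _ * _); apply: eq_bigr => j _.
  by rewrite rmorph_sum; apply: eq_bigr => k _; rewrite !rmorphM.
(* Identities between the [A i] can thus be checked on the points, where these matrices become
   diagonal up to the factor [u]. *)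
have cert (M : 'M[{poly F}]_#|[set~ (set0 : {set 'I_n})]|) :
    (forall (R : comNzRingType) (rho : {rmorphism {poly F} -> R}) x,
      (forall e, deformed_idempotent h rho (x e)) ->
      map_mx rho M *m point_matrix x = 0) -> M = 0.
  move=> MP; apply: (eq0_of_adic (@incidence_det F n)) => r.
  have [P [P0 [x [Px solx]]]] := adic r; exists P; split=> //.
  by rewrite map_mxM Px MP.
have inter (R : comNzRingType) (rho : {rmorphism {poly F} -> R}) x :
    (forall e, deformed_idempotent h rho (x e)) -> forall i,
    1 *: (map_mx rho (A i) *m point_matrix x) =
      point_matrix x *m point_diag x i *m (rho u)%:M.
  by move=> solx i; rewrite scale1r AP.
(* Take [c i = s ^+ i], with [s] outside the roots of the finitely many nonzero polynomials
   [q e]. *)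
have [c cP] : exists c : 'I_n -> F, forall e : {set 'I_n}, e != set0 ->
    \sum_(i in e) c i != 0.
  pose q (e : {set 'I_n}) : {poly F} := \sum_(i in e) 'X^i.
  have q_neq0 e : e != set0 -> q e != 0.
    move=> /set0Pn[i ie]; apply/eqP => /polyP/(_ i)/eqP.
    rewrite coef_sum (bigD1 i) //= coefXn eqxx big1 => [|j /andP[_ ne_ji]].
      by rewrite addr0 coef0 oner_eq0.
    by rewrite coefXn eq_sym (inj_eq val_inj) (negbTE ne_ji).
  have : \prod_(e : {set 'I_n} | e != set0) q e != 0 by apply/prodf_neq0.
  have [qs _|] := classic (exists s, (\prod_(e | e != set0) q e).[s] != 0).
    case: qs => s; rewrite horner_prod => /prodf_neq0 qs.
    exists (fun i => s ^+ i) => e /qs; rewrite /q horner_sum.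
    by under eq_bigr do rewrite hornerXn.
  move=> no_s; rewrite (infF (\prod_(e | e != set0) q e)) ?eqxx // => s.
  by apply/eqP; apply: contraT => qs; case: no_s; exists s.
exists A, c; split=> [i j|i j|].
- apply/eqP; rewrite -subr_eq0; apply/eqP/cert => R rho x /inter interx.
  have := intertwine2 (commD R (rho u) x) interx.
  rewrite expr1n => E2.
  by rewrite map_mxB !map_mxM mulmxBl -[X in X - _]scale1r -[X in _ - X]scale1r
    !E2 point_diagC subrr.
- apply/eqP; rewrite -subr_eq0; apply/eqP/cert => R rho x solx.
  (* Each point is fixed by the deformed map, so the cubic relation reduces to the commutation of
     diagonal matrices. *)
  have quadD k : quad (fun i j k => rho (g i j k)) (point_diag x) k =
      point_diag x k.
    by apply: quad_point_diag => e; apply: (gsum _ _ _ _ (solx e)).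
  have E3 := intertwine_cubic (commD R (rho u) x) (inter _ _ _ solx)
    (fun i j k => rho (g i j k)).
  have := E3 i j; have := E3 j i.
  rewrite !quadD expr1n !scale1r point_diagC map_mxB !map_mxM !map_quad mulmxBl.
  by move=> -> ->; rewrite subrr.
(* At ['X = 0] the points are the 0/1 vectors and [u] is 1, so the combination is conjugate to the
   diagonal matrix of the sums of [c] over nonempty sets. *)
set x0 := fun (e : {set 'I_n}) i => (i \in e)%:R : F.
have sol0 e : deformed_idempotent h (horner_eval 0) (x0 e).
  move=> i; rewrite /= /horner_eval hornerX mul0r subr0 /x0.
  by case: (i \in e); rewrite ?expr1n ?expr0n.
have := intertwine_lin (inter _ _ _ sol0) c; rewrite scale1r /= /horner_eval u0.
rewrite mulmx1 => /(congr1 determinant); rewrite !det_mulmx [RHS]mulrC.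
move/(mulIf (incidence_det F n)) => detE.
have : (\det (\sum_i (c i)%:P *: A i)).[0] != 0.
  rewrite -[_.[0]]/(horner_eval 0 _) -det_map_mx raddf_sum.
  under eq_bigr do rewrite /= map_mxZ /= /horner_eval hornerC.
  rewrite detE.
  have -> : \sum_i c i *: point_diag x0 i =
      diag_mx (\row_e \sum_(i in nonempty_set e) c i).
    apply/matrixP => a e; rewrite summxE !mxE -sumrMnl [RHS]big_mkcond.
    apply: eq_bigr => i _; rewrite !mxE /x0; case: (i \in _) => /=.
      by rewrite mulrnAr mulr1.
    by rewrite mulr0n mul0rn mulr0.
  rewrite det_diag; apply/prodf_neq0 => e _; rewrite mxE cP //.
  by have := enum_valP e; rewrite !inE.
by apply: contraNneq => ->; rewrite horner0.
Qed.

(** * Existence of idempotents or absolute nilpotents *)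

Lemma odd_card_nonempty (n : nat) :
  (0 < n)%N -> odd #|[set~ (set0 : {set 'I_n})]|.
Proof.
case: n => // n _; rewrite cardsC1 -cardsT -powersetT card_powerset cardsT.
rewrite card_ord -subn1 oddB ?expn_gt0 //.
by rewrite oddX.
Qed.

Definition quad_value (R : comNzRingType) (n : nat)
    (f : 'I_n -> 'I_n -> 'I_n -> R) (x : 'I_n -> R) (i : 'I_n) : R :=
  \sum_j \sum_k f i j k * (x j * x k).

Lemma Gamma_quadratic_eigenvector (F : fieldType) (n : nat)
    (f : 'I_n -> 'I_n -> 'I_n -> F) :
  Gamma F -> (0 < n)%N ->
  exists x : 'I_n -> F, (exists i, x i != 0) /\
    forall i j, x i * quad_value f x j = x j * quad_value f x i.
Proof.
move=> GF n_gt0; have infF := fun p => @Gamma_poly_eq0 F p GF.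
(* With the coordinatewise squares subtracted from [f], the deformed map at ['X = 1] is [f]
   itself. *)
have [A [c0 [comA quadA det0]]] := generic_commuting_family
  (fun i j k => f i j k - ((j == i) && (k == i))%:R) infF.
have [C [comC quadC [c [e [e_neq0 linC]]]]] :=
  specialize_commuting 1 infF comA quadA det0.
have [v [v_neq0 [x vC]]] := common_eigenvector GF (odd_card_nonempty n_gt0) comC.
have v_inj s t : s *: v = t *: v -> s = t.
  move/eqP; rewrite -subr_eq0 -scalerBl scaler_eq0 (negbTE v_neq0) orbF.
  by rewrite subr_eq0 => /eqP.
have com1 i : 1%:M *m C i = C i *m 1%:M by rewrite mul1mx mulmx1.
(* The eigenvector [v] intertwines the 1 by 1 matrices [x i] with the [C i], so the relations
   between the [C i] pass to the eigenvalues. *)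
have vX i : 1 *: ((x i)%:M *m v) = v *m C i *m 1%:M.
  by rewrite scale1r mul_scalar_mx mulmx1 vC.
exists x; split.
  (* If all eigenvalues were 0, then [v] times the combination [e%:M] of the [C i] would be 0. *)
  apply: NNPP => x0; case/negP: e_neq0; apply/eqP/v_inj.
  have := intertwine_lin vX c; rewrite linC scale1r mulmx1 mul_mx_scalar => <-.
  rewrite big1 ?mul0mx ?scale0r // => i _.
  have [->|xi] := eqVneq (x i) 0; first by rewrite raddf0 scaler0.
  by case: x0; exists i.
have quadX i : quad f (fun i => (x i)%:M : 'M_1) i = (quad_value f x i)%:M.
  rewrite /quad raddf_sum; apply: eq_bigr => j _; rewrite raddf_sum.
  by apply: eq_bigr => k _; rewrite -scalar_mxM scale_scalar_mx.
have quadC1 i j : C i *m quad f C j = C j *m quad f C i.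
  have quad1 l : quad f C l = quad (fun i j k => (((j == i) && (k == i))%:R +
      'X * (f i j k - ((j == i) && (k == i))%:R)%:P).[1]) C l.
    apply: eq_bigr => a _; apply: eq_bigr => b _; congr (_ *: _).
    rewrite !hornerE; case: (_ && _) => /=; rewrite ?hornerC ?horner0.
      by rewrite addrAC subrr add0r.
    by rewrite add0r subr0.
  by rewrite !quad1 quadC.
move=> i j; apply: v_inj; rewrite -!mul_scalar_mx !scalar_mxM -!quadX.
have vQ k l := intertwine_cubic com1 vX f k l.
move: (vQ i j) (vQ j i); rewrite expr1n !scale1r => -> ->.
by rewrite quadC1.
Qed.

Lemma Gamma_Lambda (F : fieldType) : Gamma F -> Lambda F.
Proof.
move=> GF A mul dimA; set n := \dim {:A} in dimA *.
pose b : n.-tuple A := vbasis {:A}.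
have bE (y : A) : y = \sum_i coord b i y *: b`_i.
  by apply: coord_vbasis; apply: memvf.
have [x [[i0 xi0] xq]] := Gamma_quadratic_eigenvector
  (fun i j k => coord b i (mul b`_j b`_k)) GF dimA.
set q := quad_value _ x in xq.
pose X := \sum_i x i *: b`_i.
have X_neq0 : X != 0.
  apply: contraNneq xi0 => X0; have /freeP freeb := basis_free (vbasisP {:A}).
  by rewrite (freeb x X0).
have XX : mul X X = (q i0 / x i0) *: X.
  transitivity (\sum_i q i *: b`_i); last first.
    rewrite scaler_sumr; apply: eq_bigr => i _; rewrite scalerA.
    by rewrite mulrAC (mulrC (q i0)) xq mulrAC mulfV // mul1r.
  transitivity (\sum_j \sum_k (x j * x k) *: mul b`_j b`_k).
    rewrite {1}/X linear_sumlz; apply: eq_bigr => j _.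
    rewrite linear_sumr; apply: eq_bigr => k _.
    by rewrite linearZl_LR linearZr_LR /= scalerA.
  rewrite [LHS]bE; apply: eq_bigr => i _; congr (_ *: _).
  rewrite linear_sum; apply: eq_bigr => j _; rewrite linear_sum.
  by apply: eq_bigr => k _; rewrite linearZ /= mulrC.
(* With [X] squaring to t times [X], either t is 0 and [X] is an absolute nilpotent, or [X] divided
   by t is an idempotent. *)
have [t0|t_neq0] := eqVneq (q i0 / x i0) 0.
  by right; exists X; split=> //; rewrite XX t0 scale0r.
left; exists ((q i0 / x i0)^-1 *: X); split.
  by rewrite scaler_eq0 invr_eq0 (negbTE t_neq0).
by rewrite linearZl_LR linearZr /= XX !scalerA mulfVK.
Qed.

Theorem theorem2p2 :
  (forall F : fieldType, Gamma' F -> Lambda F) /\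
  (forall F : fieldType, Lambda F -> Gamma F).
Proof.
by split=> F; [case=> GF _; apply: Gamma_Lambda | apply: Lambda_Gamma].
Qed.
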